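(* Let $\mathbb{F}$ be a field, let $n \ge 1$ and $k \ge 0$ be integers, let $\omega:\coprod_{m=1}^{\infty} \mathbb{S}_m \to \mathbb{F}^*=\mathbb{F}\setminus\{0\}$ be any function, and let $\mathcal{B} \subset [n]^2$. Then \[ \max \left\{\dim W: ~W \leq M_{\mathcal{B}}(\mathbb{F})~,~\rho_{\omega}(W) \leq k\right\}= \max \left\{|\mathcal{B}'|: \mathcal{B}' \subset \mathcal{B}~,~ \nu_b(\mathcal{B}') \leq k\right\}. \]
   Context: $[n]=\{1,\dots,n\}$, $M_n(\mathbb{F})$ is the space of $n\times n$ matrices over $\mathbb{F}$, $\mathbb{S}_m$ is the symmetric group on $[m]$, and $W \le V$ means $W$ is a linear subspace of $V$. For $\mathcal{B}\subset[n]^2$, $M_{\mathcal{B}}(\mathbb{F})=\{A\in M_n(\mathbb{F}): A(i,j)=0 \text{ for } (i,j)\notin\mathcal{B}\}$. A bipartite matching in $\mathcal{B}$ is a subset $\mathcal{B}_0\subset\mathcal{B}$ such that any two distinct pairs $(i,j)\ne(i',j')$ in $\mathcal{B}_0$ satisfy $i\ne i'$ and $j\ne j'$; $\nu_b(\mathcal{B})$ is the maximum size of a bipartite matching in $\mathcal{B}$. For $A\in M_m(\mathbb{F})$ define $D_\omega(A)=\sum_{\sigma\in\mathbb{S}_m}\omega(\sigma)\prod_{i=1}^m A(i,\sigma(i))$. For $A\in M_n(\mathbb{F})$ and $I=\{i_1<\dots<i_k\}$, $J=\{j_1<\dots<j_k\}\subset[n]$, $A[I|J]\in M_k(\mathbb{F})$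 is the submatrix with $(\alpha,\beta)$ entry $A(i_\alpha,j_\beta)$. The $\omega$-rank $\mathrm{rk}_\omega(A)$ is the largest $k$ such that there exist $k$-element subsets $I,J\subset[n]$ with $D_\omega(A[I|J])\neq 0$ (and $0$ if none). For $S\subset M_n(\mathbb{F})$, $\rho_\omega(S)=\max\{\mathrm{rk}_\omega(A):A\in S\}$. *)

(* Defs.v *)
From mathcomp Require Import all_boot fingroup perm all_algebra.
From mathcomp Require Import boolp.

Set Implicit Arguments.
Unset Strict Implicit.
Unset Printing Implicit Defensive.

Import GRing.Theory.
Local Open Scope ring_scope.

Definition is_max (P : nat -> Prop) (m : nat) : Prop :=
  P m /\ forall d, P d -> (d <= m)%N.

Section Patterns.
Variable n : nat.
Implicit Types B : {set 'I_n * 'I_n}.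

Definition bip_matching B : bool :=
  [forall p in B, forall q in B, (p != q) ==> (p.1 != q.1) && (p.2 != q.2)].

Definition nu_b B : nat :=
  \max_(B0 : {set 'I_n * 'I_n} | (B0 \subset B) && bip_matching B0) #|B0|.

Definition pattern_mx (F : fieldType) B : {pred 'M[F]_n} :=
  [pred A : 'M[F]_n | [forall i, forall j, ((i, j) \notin B) ==> (A i j == 0)]].

End Patterns.

Arguments pattern_mx {n} F B.

Section OmegaRank.
Variables (F : fieldType) (omega : forall m : nat, 'S_m -> F).

Definition D_omega (m : nat) (A : 'M[F]_m) : F :=
  \sum_(s : 'S_m) omega s * \prod_(i < m) A i (s i).

Variable n : nat.

(* [enum_val] enumerates a set of ordinals in increasing order. When
   #|I| = #|J| = k, [conform_mx] only recasts the #|I| x #|J| submatrix as a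
   k x k one; otherwise its value is the dummy matrix 0. *)
Definition sub_matrix (k : nat) (A : 'M[F]_n) (I J : {set 'I_n}) : 'M[F]_k :=
  conform_mx (0 : 'M[F]_k)
    (mxsub (fun a : 'I_#|I| => enum_val a) (fun b : 'I_#|J| => enum_val b) A).

(* The empty [\max] is 0. The index k = 0 contributes 0 whether or not its
   condition holds, so the rank does not depend on [omega] at m = 0. *)
Definition rk_omega (A : 'M[F]_n) : nat :=
  \max_(k < n.+1 | [exists I : {set 'I_n}, exists J : {set 'I_n},
      [&& #|I| == k, #|J| == k & D_omega (sub_matrix k A I J) != 0]]) k.

(* The bound r <= n loses nothing, since rk_omega A <= n by definition. *)
Definition rho_omega (S : {pred 'M[F]_n}) : nat :=
  \max_(r < n.+1 | `[< exists2 A, A \in S & rk_omega A = r >]) r.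

End OmegaRank.

(* Main.v *)
Require Import Defs.
From HB Require Import structures.
From mathcomp Require Import all_boot fingroup perm all_algebra.
From mathcomp Require Import boolp.

Set Implicit Arguments.
Unset Strict Implicit.
Unset Printing Implicit Defensive.

Import GRing.Theory.

(** Lower bound: if [D_omega (A[I|J]) != 0], some permutation contributes a
    nonzero product, which is a matching of size [#|I|] in the support of [A].

    Upper bound: let [B'] be the set of lexicographically first nonzero positions
    of the matrices of [W].  Restricting the matrices of [W] to [B'] is injective,
    so [\dim W <= #|B'|].  Given a matching in [B'] with row set [I] and column
    set [J], pick [A_i] in [W] led by the matched position in row [i].  In the
    matrix whose row [i] is row [i] of [A_i] only one permutation contributes, so
    its [D_omega] on [I|J] is nonzero.  As [A_l] vanishes above row [l],
    multilinearity in the rows lets one replace these rows, from the top down, by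
    those of a combination [\sum_l x_l A_l] with every [x_l] equal to 0 or 1.
    This works over every field, however small. *)

Local Open Scope ring_scope.

(** * Submatrices along injections *)

Section SubMatrix.
Variables (F : fieldType) (n m : nat).
Implicit Types I J : {set 'I_n}.

(** Trades the cast and the dummy value for two injections with images [I] and [J], fixed before [A]
    so that one pair serves every matrix. *)
Lemma sub_matrix_mxsub I J : #|I| = m -> #|J| = m ->
  exists r c : 'I_m -> 'I_n,
    [/\ injective r, injective c,
        (forall i, i \in I <-> exists a, r a = i),
        (forall j, j \in J <-> exists a, c a = j)
      & forall A : 'M[F]_n, sub_matrix m A I J = mxsub r c A].
Proof.
move=> eI eJ.
exists (fun a => enum_val (cast_ord (esym eI) a)).
exists (fun a => enum_val (cast_ord (esym eJ) a)); split.
- by move=> a b /enum_val_inj /cast_ord_inj.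
- by move=> a b /enum_val_inj /cast_ord_inj.
- move=> i; split=> [iI|[a <-]]; last exact: enum_valP.
  exists (cast_ord eI (enum_rank_in iI i)).
  by rewrite cast_ordK enum_rankK_in.
- move=> j; split=> [jJ|[a <-]]; last exact: enum_valP.
  exists (cast_ord eJ (enum_rank_in jJ j)).
  by rewrite cast_ordK enum_rankK_in.
(* Inserting the cast makes the sizes agree, so [conform_mx] returns the submatrix and not its
   default. *)
move=> A; rewrite /sub_matrix -(conform_castmx (eI, eJ)) conform_mx_id.
by apply/matrixP=> a b; rewrite castmxE !mxE.
Qed.

End SubMatrix.

(** * Multilinearity in the rows *)

Section Multilinear.
Variables (F : fieldType) (n m : nat) (om : 'S_m -> F).

Lemma triangular_combination (r c : 'I_m -> 'I_n) (A : 'I_n -> 'M[F]_n) :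
  injective r -> (forall l i j : 'I_n, (i < l)%N -> A l i j = 0) ->
  \sum_s om s * \prod_a A (r a) (r a) (c (s a)) != 0 ->
  exists x : 'I_n -> F,
    \sum_s om s * \prod_a (\sum_l x l *: A l) (r a) (c (s a)) != 0.
Proof.
move=> rI Atri D0.
(* Induction on [t]: rows with index below [t] already come from the combination, every other row
   [i] still comes from its own [A i]. *)
pose M t (x : 'I_n -> F) (i j : 'I_n) :=
  if (i < t)%N then (\sum_l x l *: A l) i j else A i i j.
pose E t x := \sum_s om s * \prod_a M t x (r a) (c (s a)).
suff /(_ n)[x Ex] : forall t, exists x, E t x != 0.
  exists x; apply: contraNneq Ex => <-; apply/eqP.
  by apply: eq_bigr => s _; congr (_ * _); apply: eq_bigr => a _; rewrite /M ltn_ord.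
elim=> [|t [x Ex]].
  by exists (fun=> 0).
(* If no selected row has index [t], the products never read row [t] and [x] is kept. *)
case: (pickP (fun a => val (r a) == t)) => [a0 /eqP ra0|nor]; last first.
  exists x; apply: contraNneq Ex => <-; apply/eqP.
  apply: eq_bigr => s _; congr (_ * _); apply: eq_bigr => a _.
  by rewrite /M ltnS [in RHS]leq_eqVlt nor.
(* Only the coefficient of the matrix attached to row [t] is changed. That matrix vanishes above row
   [t], so the rows already replaced stay as they are. *)
pose y (e : F) l := if l == r a0 then e else x l.
have yM e (i j : 'I_n) : (i < t)%N -> M t.+1 (y e) i j = M t x i j.
  move=> it; rewrite /M it (ltnW it : (i < t.+1)%N) !summxE.
  apply: eq_bigr => l _; rewrite !mxE /y; case: eqP => // ->.
  by rewrite Atri ?mulr0 // ra0.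
have yM' e a j : a != a0 -> M t.+1 (y e) (r a) j = M t x (r a) j.
  move=> aa0; case: (ltnP (r a) t) => [/yM-> //|ra].
  suff tra : (t < r a)%N by rewrite /M ltnS (leqNgt _ t) tra ltnNge ra.
  by rewrite ltn_neqAle ra andbT -ra0; apply: contra aa0 => /eqP/val_inj/rI->.
have yM0 j : M t.+1 (y 1) (r a0) j - M t.+1 (y 0) (r a0) j = M t x (r a0) j.
  rewrite /M ra0 ltnSn ltnn !summxE -sumrB (bigD1 (r a0)) //= big1 ?addr0.
    by rewrite !mxE /y eqxx mul1r mul0r subr0.
  by move=> l /negPf ll; rewrite !mxE /y ll subrr.
(* The coefficients 1 and 0 give versions of row [t] that differ by the old row [t]. By linearity in
   this row the two sums differ by [E t x], so they cannot both vanish. *)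
have Ediff : E t.+1 (y 1) - E t.+1 (y 0) = E t x.
  rewrite /E -sumrB; apply: eq_bigr => s _.
  rewrite -mulrBr; congr (_ * _).
  rewrite !(bigD1 a0 (P := xpredT)) //= -yM0 mulrBl.
  by congr (_ * _ - _ * _); apply: eq_bigr => a aa0; apply: yM'.
have [E0|E0] := eqVneq (E t.+1 (y 0)) 0; last by exists (y 0).
by exists (y 1); rewrite -Ediff E0 subr0 in Ex.
Qed.

(* Only [s0] contributes: the sums over [a] of [c (s a)] and of
   [c (s0 a)] agree, so [c (s a) >= c (s0 a)] for all [a] forces equality. *)
Lemma staircase_sum_neq0 (c : 'I_m -> 'I_n) (s0 : 'S_m) (R : 'I_m -> 'I_n -> F) :
  injective c -> (forall s, om s != 0) ->
  (forall a, R a (c (s0 a)) != 0) ->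
  (forall a (j : 'I_n), (j < c (s0 a))%N -> R a j = 0) ->
  \sum_s om s * \prod_a R a (c (s a)) != 0.
Proof.
move=> cI om0 R1 R0; rewrite (bigD1 s0) //= [X in _ + X]big1 ?addr0.
  by rewrite mulf_neq0 //; apply/prodf_neq0.
move=> s ss0; apply/eqP; rewrite mulf_eq0 prodf_seq_eq0; apply/orP; right.
apply: contraNT ss0 => /hasPn Rs.
have le a : (c (s0 a) <= c (s a) ?= iff (s0 a == s a))%N.
  split; last by rewrite (inj_eq val_inj) (inj_eq cI).
  rewrite leqNgt; apply/negP=> /R0 Rsa.
  by have := Rs a (mem_index_enum _); rewrite Rsa eqxx.
have [_] := leqif_sum (P := xpredT) (fun a _ => le a).
have perm_sum (u : 'S_m) : (\sum_a c (u a) = \sum_a c a)%N.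
  by rewrite [RHS](reindex_inj (@perm_inj _ u)).
rewrite !perm_sum eqxx => /esym/forallP ss.
by apply/eqP/permP=> a; rewrite (eqP (ss a)).
Qed.

End Multilinear.

(** * Matchings, patterns and leading positions *)

Section Patterns.
Variables (F : fieldType) (n : nat).
Implicit Types (B : {set 'I_n * 'I_n}) (W : {vspace 'M[F]_n}).

Lemma bip_matchingP B :
  reflect ({in B &, injective fst} /\ {in B &, injective snd}) (bip_matching B).
Proof.
apply: (iffP idP) => [mB|[i1 i2]].
  have H p q : p \in B -> q \in B -> p != q -> (p.1 != q.1) && (p.2 != q.2).
    by move=> pB qB; move/forall_inP: mB => /(_ p pB)/forall_inP/(_ q qB)/implyP.
  by split=> p q pB qB e; apply/eqP; apply: contraT => /(H p q pB qB);
     rewrite e eqxx ?andbF.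
apply/forall_inP=> p pB; apply/forall_inP=> q qB; apply/implyP=> pq.
apply/andP; split; apply: contra pq => /eqP e; apply/eqP; first exact: i1.
exact: i2.
Qed.

Lemma pattern_mx_space B : exists W,
  {subset W <= pattern_mx F B} /\ \dim W = #|B|.
Proof.
pose psi (v : 'rV[F]_#|B|) : 'M[F]_n :=
  \sum_a v 0 a *: delta_mx (enum_val a).1 (enum_val a).2.
have psi_lin : linear psi.
  move=> k u v; rewrite /psi scaler_sumr -big_split; apply: eq_bigr => a _ /=.
  by rewrite !mxE scalerDl scalerA.
pose psiL := GRing.isLinear.Build _ _ _ _ psi psi_lin.
pose f : {linear 'rV[F]_#|B| -> 'M[F]_n} := HB.pack psi psiL.
exists (limg (linfun f)); split.
  move=> A /memv_imgP[v _ ->]; rewrite lfunE /=.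
  apply/forallP=> i; apply/forallP=> j; apply/implyP=> ijB.
  rewrite summxE big1 // => a _; rewrite !mxE.
  case: andP => [[/eqP ei /eqP ej]|]; last by rewrite mulr0.
  by rewrite ei ej -surjective_pairing enum_valP in ijB.
rewrite limg_dim_eq ?dimvf /dim /= ?mul1n //.
apply/eqP; rewrite -subv0; apply/subvP=> v /memv_capP[_].
rewrite memv_ker (lfunE f) memv0 /= => /eqP/matrixP v0.
apply/eqP/rowP=> a; rewrite mxE.
have := v0 (enum_val a).1 (enum_val a).2.
rewrite summxE (bigD1 a) //= big1 ?addr0; first by rewrite !mxE !eqxx mulr1.
move=> b ba; rewrite !mxE; case: andP => [[/eqP e1 /eqP e2]|]; last by rewrite mulr0.
case/eqP: ba; apply: enum_val_inj.
by rewrite [LHS]surjective_pairing [RHS]surjective_pairing e1 e2.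
Qed.

(** The lexicographic condition is split in two: vanishing above the row serves
    [triangular_combination], vanishing to the left serves [staircase_sum_neq0]. *)
Definition leads (A : 'M[F]_n) (p : 'I_n * 'I_n) : Prop :=
  [/\ A p.1 p.2 != 0,
      (forall i j : 'I_n, (i < p.1)%N -> A i j = 0)
    & (forall j : 'I_n, (j < p.2)%N -> A p.1 j = 0)].

Lemma leads_exists A : A != 0 -> exists p, leads A p.
Proof.
move=> A0.
have [p0 p0A] : exists p : 'I_n * 'I_n, A p.1 p.2 != 0.
  apply: contra_neqP A0 => nA; apply/matrixP=> i j; rewrite mxE.
  by apply/eqP; apply: contra_notT nA => Aij; exists (i, j).
(* As column indices are below [n], the number [p.1 * n + p.2] orders positions
   lexicographically. *)
case: (@arg_minnP _ p0 (fun p => A p.1 p.2 != 0)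
         (fun p : 'I_n * 'I_n => p.1 * n + p.2)%N p0A) => p pA pmin.
exists p; split=> // [i j ip|j jp]; apply/eqP; apply: contraT.
  move=> /(pmin (i, j)) /=; rewrite leqNgt => /negP[].
  apply: leq_trans (leq_addr _ _).
  by apply: leq_trans (leq_mul ip (leqnn n)); rewrite mulSn addnC ltn_add2r.
by move=> /(pmin (p.1, j)) /=; rewrite leq_add2l leqNgt jp.
Qed.

Definition lead_set W : {set 'I_n * 'I_n} :=
  [set p | `[< exists2 A, A \in W & leads A p >]].

Lemma dim_le_lead_set W : (\dim W <= #|lead_set W|)%N.
Proof.
pose phi (A : 'M[F]_n) : 'rV[F]_#|lead_set W| :=
  \row_a A (enum_val a).1 (enum_val a).2.
have phi_lin : linear phi by move=> k u v; apply/rowP=> a; rewrite !mxE.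
pose phiL := GRing.isLinear.Build _ _ _ _ phi phi_lin.
pose f : {linear 'M[F]_n -> 'rV[F]_#|lead_set W|} := HB.pack phi phiL.
rewrite -(@limg_dim_eq _ _ _ (linfun f) W).
  by apply: leq_trans (dimvS (subvf _)) _; rewrite dimvf /dim /= mul1n.
apply/eqP; rewrite -subv0; apply/subvP=> A /memv_capP[AW].
rewrite memv_ker (lfunE f) memv0 /= => /eqP/rowP A0.
apply: contraT => /leads_exists[p pA].
have pW : p \in lead_set W by rewrite inE; apply/asboolP; exists A.
have := A0 (enum_rank_in pW p); rewrite !mxE enum_rankK_in // => Ap.
by case: pA; rewrite Ap eqxx.
Qed.

Lemma lead_set_sub W B :
  {subset W <= pattern_mx F B} -> lead_set W \subset B.
Proof.
move=> WB; apply/subsetP=> p; rewrite inE => /asboolP[A /WB AB [Ap _ _]].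
apply: contraNT Ap => pB.
move/forallP/(_ p.1)/forallP/(_ p.2)/implyP: AB; apply.
by rewrite -surjective_pairing.
Qed.

End Patterns.

(** * Rank against matching number *)

Section Rank.
Variables (F : fieldType) (n : nat) (omega : forall m : nat, 'S_m -> F).
Hypothesis omega_neq0 : forall m (s : 'S_m), (1 <= m)%N -> omega s != 0.
Implicit Types (B : {set 'I_n * 'I_n}) (W : {vspace 'M[F]_n}).

Lemma rk_omega_le_nu_b B (A : 'M[F]_n) :
  A \in pattern_mx F B -> (rk_omega omega A <= nu_b B)%N.
Proof.
move=> AB; apply/bigmax_leqP=> m /existsP[I /existsP[J /and3P[/eqP eI /eqP eJ]]].
have [r [c [rI cI _ _ ->]]] := sub_matrix_mxsub F eI eJ => D0.
have [s sP] : exists s : 'S_m, forall a, A (r a) (c (s a)) != 0.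
  apply: contra_neqP D0 => nos; apply: big1 => s _.
  apply/eqP; rewrite mulf_eq0 prodf_seq_eq0; apply/orP; right.
  apply: contra_notT nos => /hasPn As; exists s => a.
  by have := As a (mem_index_enum _); rewrite mxE.
pose g a := (r a, c (s a)).
have gI : injective g by move=> a b [/rI].
have -> : nat_of_ord m = #|[set g a | a : 'I_m]| by rewrite card_imset ?card_ord.
apply: leq_bigmax_cond; apply/andP; split.
  apply/subsetP=> _ /imsetP[a _ ->]; apply: contraT => gB.
  move/forallP/(_ (r a))/forallP/(_ (c (s a)))/implyP/(_ gB): AB.
  by rewrite (negPf (sP a)).
apply/bip_matchingP; split=> _ _ /imsetP[a _ ->] /imsetP[b _ ->] /=.
  by move=> /rI->.
by move=> /cI/perm_inj->.
Qed.

Lemma nu_b_lead_set_le_rho W : (nu_b (lead_set W) <= rho_omega omega W)%N.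
Proof.
apply/bigmax_leqP=> B0 /andP[B0W /bip_matchingP[inj1 inj2]].
(* The empty matching is set apart because [omega] is known to be nonzero only for sizes at least
   1. *)
have [-> //|m_gt0] := posnP #|B0|.
pose I := [set p.1 | p in B0]; pose J := [set p.2 | p in B0].
have eI : #|I| = #|B0| by apply: card_in_imset.
have eJ : #|J| = #|B0| by apply: card_in_imset.
have [r [c [rI cI rP cP subE]]] := sub_matrix_mxsub F eI eJ.
have /choice[Ad Adp] (i : 'I_n) : exists Ad : 'M[F]_n * 'I_n,
    [/\ Ad.1 \in W, (forall i' j : 'I_n, (i' < i)%N -> Ad.1 i' j = 0)
      & i \in I -> (i, Ad.2) \in B0 /\ leads Ad.1 (i, Ad.2)].
  have [/imsetP[[i1 j] pB0 /= ->]|_] := boolP (i \in I); last first.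
    (* Rows outside [I] get the zero matrix, so the vanishing condition holds for every index; the
       column [i] is arbitrary. *)
    by exists (0, i); split; rewrite ?mem0v // => i' j _; rewrite mxE.
  have := subsetP B0W _ pB0; rewrite inE => /asboolP[A AW lA].
  by exists (A, j); split=> //; case: lA.
have rB0 a : r a \in I by apply/rP; exists a.
have AdB0 a : (r a, (Ad (r a)).2) \in B0 by case: (Adp (r a)) => _ _ /(_ (rB0 a))[].
(* [s0] is the matching read as a permutation: row [r a] is matched to column [c (s0 a)]. *)
have /choice[s0 s0P] (a : 'I_#|B0|) : exists b, c b = (Ad (r a)).2.
  by apply/cP; apply/imsetP; exists (r a, (Ad (r a)).2).
have s0I : injective s0.
  move=> a b e; have := inj2 _ _ (AdB0 a) (AdB0 b).
  by rewrite /= -!s0P e => /(_ erefl)[/rI].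
have D0 : \sum_s omega s * \prod_a (Ad (r a)).1 (r a) (c (s a)) != 0.
  apply: (@staircase_sum_neq0 _ _ _ (@omega _) c (perm s0I)
            (fun a j => (Ad (r a)).1 (r a) j)) => // [s|a|a j].
  - exact: omega_neq0.
  - by rewrite permE s0P; case: (Adp (r a)) => _ _ /(_ (rB0 a))[_ []].
  - by rewrite permE s0P; case: (Adp (r a)) => _ _ /(_ (rB0 a))[_ [_ _]]; apply.
have [|x Dx] := @triangular_combination _ _ _ (@omega _) r c
                  (fun l => (Ad l).1) rI _ D0.
  by move=> l i j il; case: (Adp l) => _ + _; apply.
pose A := \sum_l x l *: (Ad l).1.
have AW : A \in W.
  by apply: memv_suml => l _; apply: memvZ; case: (Adp l).
have m_le_n : (#|B0| < n.+1)%N by rewrite ltnS -eI -[leqRHS]card_ord max_card.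
have rk_ge : (#|B0| <= rk_omega omega A)%N.
  apply: (@leq_bigmax_cond _ _ (fun m : 'I_n.+1 => m : nat) (Ordinal m_le_n)).
  apply/existsP; exists I; apply/existsP; exists J.
  rewrite eI eJ !eqxx /= subE; apply: contraNneq Dx => DA; apply/eqP; rewrite -[RHS]DA.
  by apply: eq_bigr => s _; congr (_ * _); apply: eq_bigr => a _; rewrite mxE.
have rk_lt : (rk_omega omega A < n.+1)%N.
  by rewrite ltnS; apply/bigmax_leqP=> m _; rewrite -ltnS ltn_ord.
apply: leq_trans rk_ge _.
apply: (@leq_bigmax_cond _ _ (fun m : 'I_n.+1 => m : nat) (Ordinal rk_lt)).
by apply/asboolP; exists A.
Qed.

End Rank.

Theorem theorem1p5 (F : fieldType) (n k : nat) (hn : (1 <= n)%N)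
    (omega : forall m : nat, 'S_m -> F)
    (homega : forall (m : nat) (s : 'S_m), (1 <= m)%N -> omega m s != 0)
    (B : {set 'I_n * 'I_n}) :
  is_max
    (fun d : nat => exists W : {vspace 'M[F]_n},
       [/\ {subset W <= pattern_mx F B},
           (rho_omega omega W <= k)%N
         & \dim W = d])
    (\max_(B' : {set 'I_n * 'I_n} | (B' \subset B) && (nu_b B' <= k)%N) #|B'|).
Proof.
split; last first.
  (* The set [lead_set W] competes in the combinatorial maximum. *)
  move=> _ [W [WB rhoW <-]]; apply: leq_trans (dim_le_lead_set W) _.
  apply: leq_bigmax_cond; rewrite lead_set_sub //=.
  exact: leq_trans (nu_b_lead_set_le_rho homega W) rhoW.
have [|B' /andP[B'B nuB'] ->] := @eq_bigmax_cond _
    [pred B' : {set 'I_n * 'I_n} | (B' \subset B) && (nu_b B' <= k)%N]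
    (fun B' : {set 'I_n * 'I_n} => #|B'|).
  (* The maximum is attained because the empty set is always admissible. *)
  apply/card_gt0P; exists set0; rewrite inE sub0set; apply/bigmax_leqP=> B0.
  by rewrite subset0 => /andP[/eqP-> _]; rewrite cards0.
have [W [WB' dimW]] := pattern_mx_space F B'.
exists W; split=> //.
  move=> A /WB' AB'; apply/forallP=> i; apply/forallP=> j; apply/implyP=> ijB.
  move/forallP/(_ i)/forallP/(_ j)/implyP: AB'; apply.
  by apply: contra ijB; apply: (subsetP B'B).
apply/bigmax_leqP=> r /asboolP[A /WB' AB' <-].
exact: leq_trans (rk_omega_le_nu_b omega AB') nuB'.
Qed.
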